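(* Assume that $X[\mathcal{T}]$ is a locally convex topological vector space; $\mathcal{C}$ is a non-decreasing countable localizing family in $X$; each member of $\mathcal{C}$ is $\mathcal{T}$-closed; a subset of $X$ is $\mathcal{T}_{\mathcal{C}}$-bounded if and only if it is contained in some $C\in\mathcal{C}$; and there exists $C_0\in\mathcal{C}$ such that for each $C\in\mathcal{C}$ there exists $t>0$ with $C\subseteq t\cdot C_0$. Then $X[\mathcal{T}_{\mathcal{C}}]^*[\beta(X^*,X)]$ is a Banach space.
   Context: All vector spaces are real; topological vector spaces are Hausdorff. $X[\mathcal{T}]$ denotes $X$ equipped with the topology $\mathcal{T}$; $\mathcal{T}|_C=\{E\cap C:E\in\mathcal{T}\}$. A localizing family in a vector space $X$ is a non-empty collection $\mathcal{C}$ of convex subsets of $X$ containing $0$ such that for all $C\in\mathcal{C}$, $x\in X$, $t\in\mathbb{R}$ there is $D\in\mathcal{C}$ with $x+t\cdot C\subseteq D$. It is non-decreasing countable if it can be numbered $\mathcal{C}=\{C_k:k\in\mathbb{N}\}$ with $C_k\subseteq C_{k+1}$ for all $k$. The localization $\mathcal{T}_{\mathcal{C}}$ is the locally convex vector topology on $X$ consisting of all $E\subseteq X$ such that for every $x\in E$ there is a convex $V$ with $x\in V\subseteq E$ and $V\cap C\in\mathcal{T}|_C$ for every $C\in\mathcal{C}$. $X[\mathcal{T}_{\mathcal{C}}]^*$ is the space of $\mathcal{T}_{\mathcal{C}}$-continuous linear forms on $X$; $\beta(X^*,X)$ is its strong topology (uniform convergence on $\mathcal{T}_{\mathcal{C}}$-bounded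 subsets of $X$). ''Is a Banach space'' means that the topology is induced by a complete norm. *)

(* Defs.v *)
From HB Require Import structures.
From mathcomp Require Import all_boot all_order all_algebra.
From mathcomp Require Import all_classical all_reals all_analysis.

Set Implicit Arguments.
Unset Strict Implicit.
Unset Printing Implicit Defensive.

Import Order.TTheory GRing.Theory Num.Theory.
Import numFieldNormedType.Exports.

Local Open Scope classical_set_scope.
Local Open Scope ring_scope.

Section LocalizingFamily.
Context {R : realType} {X : lmodType R}.
Implicit Type C : set_system X.

Definition localizing_family C :=
  [/\ C !=set0,
      forall A, C A -> convex_set A /\ A 0 &
      forall A (x : X) (t : R), C A ->
        exists2 D, C D & [set x + t *: y | y in A] `<=` D].

Definition nondecreasing_countable C :=
  exists2 F : nat -> set X, C = range F & forall k, F k `<=` F k.+1.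

End LocalizingFamily.

(* The vector space X on its own, re-topologized by T_C: a type alias, so that
   continuity and boundedness on it refer to T_C and not to the topology of X.
   The open sets below form a topology for an arbitrary C. *)
Definition localization {R : realType} {X : tvsType R} (C : set_system X)
  : Type := X.

Section Localization.
Context {R : realType} {X : tvsType R} (C : set_system X).

HB.instance Definition _ := GRing.Lmodule.copy (localization C) X.

Definition localization_open (E : set X) :=
  forall x, E x -> exists V : set X,
    [/\ convex_set V, V x, V `<=` E &
        forall A, C A -> exists2 U : set X, open U & V `&` A = U `&` A].

Let localization_openT : localization_open setT.
Proof.
by move=> x _; exists setT; split=> // A _; exists setT => //; exact: openT.
Qed.

Let localization_openI : setI_closed localization_open.
Proof.
move=> E F oE oF x [/oE[V [cV Vx VE VC]] /oF[W [cW Wx WF WC]]].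
exists (V `&` W); split => //.
- move=> y z l /[!inE] -[Vy Wy] [Vz Wz]; split; apply/set_mem.
  + by apply: cV; exact/mem_set.
  + by apply: cW; exact/mem_set.
- exact: setISS.
- move=> A CA; have [U oU VU] := VC _ CA; have [U' oU' WU'] := WC _ CA.
  exists (U `&` U'); first exact: openI.
  by rewrite setIIl VU WU' -setIIl.
Qed.

Let localization_open_bigU (I : Type) (f : I -> set X) :
  (forall i, localization_open (f i)) -> localization_open (\bigcup_i f i).
Proof.
move=> of_ x [i _ /of_[V [cV Vx Vf VC]]].
by exists V; split => // y /Vf; exists i.
Qed.

HB.instance Definition _ := isOpenTopological.Build (localization C)
  localization_openT localization_openI localization_open_bigU.

End Localization.

Definition tvs_bounded {R : realType} {E : preTopologicalLmodType R}
    (B : set E) :=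
  forall U : set E, nbhs 0 U ->
    \forall t \near (+oo : set_system R), B `<=` [set t *: u | u in U].

Section StrongDual.
Context {R : realType} (E : preTopologicalLmodType R).

Definition continuous_form : {pred E -> R^o} :=
  fun f => `[< linear f /\ continuous f >].

Let continuous_form_submod : submod_closed continuous_form.
Proof.
split.
- apply/asboolP; split; last by move=> x; exact: cvg_cst.
  by move=> a x y /=; rewrite scaler0 addr0.
- move=> a f g /asboolP[lf cf] /asboolP[lg cg]; apply/asboolP; split.
    move=> b x y; rewrite !fctE lf lg !scalerDr !scalerA (mulrC a b).
    by rewrite addrACA.
  by move=> x; apply: cvgD; [apply: cvgZr; exact: cf|exact: cg].
Qed.

HB.instance Definition _ :=
  GRing.isSubmodClosed.Build R (E -> R^o) continuous_form
    continuous_form_submod.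

Record strong_dual := StrongDual {
  dual_fun :> E -> R^o ;
  dual_funP : dual_fun \in continuous_form }.

HB.instance Definition _ := [isSub for dual_fun].
HB.instance Definition _ := [Choice of strong_dual by <:].
HB.instance Definition _ := [SubChoice_isSubLmodule of strong_dual by <:].

(* Uniform convergence on the bounded subsets of E. *)
HB.instance Definition _ := Topological.copy strong_dual
  (initial_topology
    (dual_fun : strong_dual -> {family @tvs_bounded R E, E -> R^o})).

End StrongDual.

Section Banach.
Context {R : realType} {V : preTopologicalLmodType R}.
Implicit Type N : V -> R.

Definition is_norm N :=
  [/\ forall x y, N (x + y) <= N x + N y,
      forall (a : R) x, N (a *: x) = `|a| * N x &
      forall x, N x = 0 -> x = 0].

Definition norm_complete N :=
  forall u : nat -> V,
    (forall e : R, 0 < e -> exists n0, forall m n,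
       (n0 <= m)%N -> (n0 <= n)%N -> N (u m - u n) < e) ->
    exists l : V, (N (u n - l) @[n --> \oo] --> (0 : R)).

Definition norm_induces_topology N :=
  forall x : V, nbhs x = nbhs_ball_ (ball_ N) x.

End Banach.

Definition banach_space {R : realType} (V : preTopologicalLmodType R) :=
  exists N : V -> R, [/\ is_norm N, norm_complete N & norm_induces_topology N].

(* Main.v *)
(* Every bounded set lies in some A in C, hence in a multiple of C0, so the
   strong topology is that of the norm N f = sup_C0 |f|. The N-limit l of a
   Cauchy sequence of forms is a uniform limit on C0, hence on every A in C, so
   the restriction of l to A is continuous for the original topology. The sets
   {z : |l x - l z| < r} are convex and relatively open in every A, which is
   exactly what makes l continuous for the localization. *)
Require Import Defs.
From HB Require Import structures.
From mathcomp Require Import all_boot all_order all_algebra.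
From mathcomp Require Import all_classical all_reals all_analysis.
From mathcomp Require Import ring lra.

Import Order.TTheory GRing.Theory Num.Theory.
Import numFieldNormedType.Exports.

Local Open Scope classical_set_scope.
Local Open Scope ring_scope.

Lemma linear_formZ (R : realType) (E : lmodType R) (l : E -> R^o) :
  linear l -> forall (a : R) x, l (a *: x) = a * l x.
Proof.
move=> ll a x; rewrite -[a *: x]addr0 ll.
suff -> : l 0 = 0 by rewrite addr0.
by have := ll (-1) 0 0; rewrite scaler0 addr0 scaleN1r addNr.
Qed.

Lemma convex_preimage_ball (R : realType) (E : lmodType R)
  (l : E -> R^o) (c r : R) : linear l -> convex_set [set x | `|c - l x| < r].
Proof.
move=> ll x y k /[!inE]/= xr yr.
rewrite [conv _ _ _]/(_ *: x + _ *: y) ll (linear_formZ _ _ _ ll).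
have k0 : 0 <= k%:num by [].
have k1 : 0 <= 1 - k%:num by rewrite subr_ge0.
set a := l x in xr *; set b := l y in yr *.
(* Passing to the maximum keeps the bound by [r] strict even when one of the two weights
   vanishes. *)
pose M := Num.max `|c - a| `|c - b|.
apply: (@le_lt_trans _ _ M); last by rewrite gt_max xr.
have -> : c - (k%:num *: a + (1 - k%:num) * b) =
    k%:num * (c - a) + (1 - k%:num) * (c - b).
  by rewrite /GRing.scale/=; ring.
rewrite (le_trans (ler_normD _ _))// !normrM (ger0_norm k0) (ger0_norm k1).
rewrite -[leRHS](_ : k%:num * M + (1 - k%:num) * M = M); last by ring.
by rewrite lerD// ler_wpM2l// le_max lexx ?orbT.
Qed.

Section StrongDualTopology.
Context {R : realType} {E : preTopologicalLmodType R}.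
Implicit Types (f g : strong_dual E) (B : set E).

Lemma dual_linear f : linear f.
Proof. by have /asboolP[] := dual_funP f. Qed.

Lemma dual_continuous f : continuous f.
Proof. by have /asboolP[] := dual_funP f. Qed.

Lemma dual_funZ f (a : R) x : f (a *: x) = a * f x.
Proof. exact: (linear_formZ _ _ _ (dual_linear f)). Qed.

Lemma dual_fun0 f : f 0 = 0.
Proof. by rewrite -(scale0r 0) dual_funZ mul0r. Qed.

Lemma dual_bounded f B : tvs_bounded B ->
  exists M : R, forall y, B y -> `|f y| <= M.
Proof.
move=> bB; have /bB : nbhs (0 : E) (f @^-1` ball (0 : R) 1).
  by apply: dual_continuous; rewrite dual_fun0; exact: nbhsx_ballx.
(* [M] is only a threshold for the absorbing factors and may be negative; [|M| + 1] lies beyond it,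
   is positive, and serves as the bound because [|f u| < 1]. *)
case=> M [_ /(_ (`|M| + 1))] BM; exists (`|M| + 1) => y /BM.
have -> : M < `|M| + 1 by rewrite (le_lt_trans (ler_norm _))// ltrDl.
move=> /(_ isT)[u /=]; rewrite /ball/= sub0r normrN => u1 <-.
rewrite dual_funZ normrM [`|_ + 1|]ger0_norm ?addr_ge0//.
by rewrite ler_piMr ?addr_ge0// ltW.
Qed.

Lemma nbhs_strong_dual f B (e : R) : tvs_bounded B -> 0 < e ->
  nbhs f [set g | forall y, B y -> `|f y - g y| < e].
Proof.
move=> bB e0.
have := @fam_nbhs E R^o tvs_bounded B [set xy | `|xy.1 - xy.2| < e] f.
move=> /(_ (entourage_ball _ (PosNum e0)) bB).
exact: (@initial_continuous _ _
  (@dual_fun R E : _ -> {family @tvs_bounded R E, E -> R^o})).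
Qed.

(** Converse to [nbhs_strong_dual]: together they say that these sets generate the neighbourhood
    filter of [f], so the initial topology need not be unfolded again. *)
Lemma cvg_strong_dual (F : set_system (strong_dual E)) f : Filter F ->
  (forall B (e : R), tvs_bounded B -> 0 < e ->
    F [set g | forall y, B y -> `|f y - g y| < e]) ->
  F --> f.
Proof.
move=> FF Ff A; rewrite nbhsE => -[_ [[W oW <-] Wf] /filterS]; apply.
have /fam_cvgP : forall B, tvs_bounded B ->
    {uniform B, (@dual_fun R E) @ F --> (f : E -> R^o)}.
  move=> B bB P /uniform_nbhs[Q [+ QP]].
  rewrite -entourage_ballE => -[e/= e0 eQ].
  apply: filterS (Ff _ _ bB e0) => g fg; apply: QP => y By.
  by apply: eQ; exact: fg.
by apply; exact: open_nbhs_nbhs.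
Qed.

End StrongDualTopology.

Section DualNorm.
Context {R : realType} {E : preTopologicalLmodType R} (B0 : set E).
Implicit Types (f g : strong_dual E) (B : set E).

(** The gauge of the absolute polar of [B0]. The [sup] is a genuine one once [B0] is nonempty and
    bounded, by [dual_bounded]. *)
Definition dual_norm f : R := sup [set `|f y| | y in B0].

Hypothesis B0_neq0 : B0 !=set0.
Hypothesis B0_bounded : tvs_bounded B0.
Hypothesis B0_absorbs : forall B, tvs_bounded B ->
  exists2 t : R, 0 < t & B `<=` [set t *: y | y in B0].
Hypothesis points_bounded : forall x : E, tvs_bounded [set x].

Lemma le_dual_norm f y : B0 y -> `|f y| <= dual_norm f.
Proof.
move=> B0y; apply: ub_le_sup; last by exists y.
have [M fM] := dual_bounded f _ B0_bounded.
by exists M => _ [z /fM ? <-].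
Qed.

Lemma dual_norm_le f (M : R) :
  (forall y, B0 y -> `|f y| <= M) -> dual_norm f <= M.
Proof.
move=> fM; apply: ge_sup; last by move=> _ [y /fM ? <-].
by have [y B0y] := B0_neq0; exists `|f y|, y.
Qed.

Lemma dual_norm_is_norm : is_norm dual_norm.
Proof.
have scale_le (a : R) f : dual_norm (a *: f) <= `|a| * dual_norm f.
  apply: dual_norm_le => y B0y; rewrite [X in `|X|]/(a * f y) normrM.
  by rewrite ler_wpM2l// le_dual_norm.
split.
- move=> f g; apply: dual_norm_le => y B0y.
  by rewrite (le_trans (ler_normD (f y) (g y)))// lerD ?le_dual_norm.
- move=> a f; apply/eqP; rewrite eq_le scale_le/=.
  (* For [a != 0] the reverse inequality is [scale_le] applied to [a^-1] and [a *: f]. *)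
  have [->|a0] := eqVneq a 0.
    rewrite normr0 mul0r scale0r; have [y B0y] := B0_neq0.
    exact: le_trans (le_dual_norm _ _ B0y).
  rewrite -[X in _ * dual_norm X](scalerK a0) -ler_pdivlMl ?normr_gt0//.
  by rewrite -normfV scale_le.
- move=> f f0; apply/val_inj/funext => x /=.
  (* Every point is a multiple of a point of [B0], so a form vanishing on [B0] is zero. *)
  have [t _ /(_ x erefl)[y B0y <-]] := B0_absorbs _ (points_bounded x).
  have := le_dual_norm f _ B0y; rewrite f0 normr_le0 => /eqP fy0.
  by rewrite dual_funZ fy0 mulr0.
Qed.

Lemma dual_norm_induces_topology : norm_induces_topology dual_norm.
Proof.
move=> f; apply/seteqP; split => A; last first.
  case=> e /= e0 eA.
  (* Strict bounds on [B0] give only a weak bound on the supremum; halving restores strictness. *)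
  have e2 : 0 < e / 2 by rewrite divr_gt0.
  apply: filterS (nbhs_strong_dual f _ _ B0_bounded e2) => g fg.
  apply: eA => /=; apply: (@le_lt_trans _ _ (e / 2)); last by lra.
  by apply: dual_norm_le => y /fg /ltW.
have FF : Filter (nbhs_ball_ (ball_ dual_norm) f).
  apply: filter_from_filter; first by exists 1; exact: ltr01.
  move=> e d /= e0 d0; exists (Num.min e d); first by rewrite /= lt_min e0.
  by move=> g /=; rewrite lt_min => /andP[].
move: A; apply: (cvg_strong_dual _ _ FF) => B e bB e0.
have [t t0 Bt] := B0_absorbs _ bB.
exists (e / t); first by rewrite /= divr_gt0.
move=> g /= fg _ /Bt[y B0y <-]; rewrite !dual_funZ -mulrBr normrM gtr0_norm//.
rewrite mulrC -ltr_pdivlMr//.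
exact: le_lt_trans (le_dual_norm (f - g) _ B0y) fg.
Qed.

(** The premise isolates continuity of the limit, which depends on how the topology of [E] is built.
    The limit itself is formed pointwise, since [B0] absorbs points, and the Cauchy condition makes
    it uniform on [B0]. *)
Lemma dual_norm_complete :
  (forall l : E -> R^o, linear l ->
    (forall e : R, 0 < e ->
      exists f : strong_dual E, forall y, B0 y -> `|f y - l y| <= e) ->
    continuous l) ->
  norm_complete dual_norm.
Proof.
move=> closed_dual u uC.
have cvgu x : cvg ((u n x : R^o) @[n --> \oo]).
  apply: (@cauchy_cvg R^o); apply: cauchy_exP => e e0.
  have [t t0 /(_ x erefl)[y B0y <-]] := B0_absorbs _ (points_bounded x).
  have [n0 n0P] := uC _ (divr_gt0 e0 t0).
  exists (u n0 (t *: y) : R^o), n0 => // n /= n0n.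
  rewrite /ball/= !dual_funZ -mulrBr normrM gtr0_norm// mulrC -ltr_pdivlMr//.
  exact: le_lt_trans (le_dual_norm (u n0 - u n) _ B0y) (n0P _ _ _ n0n).
pose l x : R^o := lim ((u n x : R^o) @[n --> \oo]).
have ul x : (u n x : R^o) @[n --> \oo] --> l x by exact: cvgu.
have ll : linear l.
  move=> a x y; apply: cvg_lim => //.
  under eq_fun do rewrite dual_linear.
  by apply: cvgD => //; apply: cvgZr.
have unif (e : R) : 0 < e -> exists n0, forall n, (n0 <= n)%N ->
    forall y, B0 y -> `|u n y - l y| <= e.
  move=> e0; have e2 : 0 < e / 2 by rewrite divr_gt0.
  have [n0 n0P] := uC _ e2; exists n0 => n n0n y B0y.
  (* The index [m] depends on [y], but it enters only through the intermediate term [maxn m n0];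
     [n0] does not depend on [y]. *)
  have /cvgrPdist_le/(_ _ e2)[m _ mP] := ul y.
  have := mP (maxn m n0) (leq_maxl _ _).
  have := n0P n (maxn m n0) n0n (leq_maxr _ _).
  move=> /(le_lt_trans (le_dual_norm _ _ B0y)).
  rewrite [X in `|X|]/(u n y - u (maxn m n0) y) => /ltW unm ulm.
  rewrite (splitr e) (le_trans (ler_distD (u (maxn m n0) y) _ _))// lerD//.
  by rewrite distrC.
have lc : continuous l.
  apply: closed_dual => // e /unif[n nP].
  by exists (u n) => y B0y; exact: nP.
have lP : l \in @continuous_form R E by apply/asboolP.
exists (StrongDual lP); apply/cvgrPdist_le => e /unif[n0 n0P].
exists n0 => // n /= n0n; rewrite sub0r normrN ger0_norm.
  by apply: dual_norm_le => y B0y; exact: n0P.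
have [y B0y] := B0_neq0; exact: le_trans (le_dual_norm _ _ B0y).
Qed.

End DualNorm.

Lemma localization_continuous (R : realType) (X : tvsType R) (C : set_system X)
    (l : localization C -> R^o) :
  linear l ->
  (forall A (e : R), C A -> 0 < e ->
    exists2 f : localization C -> R^o, continuous f &
      forall y, A y -> `|f y - l y| <= e) ->
  continuous l.
Proof.
move=> ll lf; apply/continuousP => E oE.
change (localization_open C (l @^-1` E)) => x Ex.
have [r /= r0 rE] := (@nbhs_ballP _ _ _ _).1 (open_nbhs_nbhs (conj oE Ex)).
exists [set z | `|l x - l z| < r]; split.
- exact: convex_preimage_ball.
- by rewrite /= subrr normr0.
- by move=> z /= xz; apply: rE.
move=> A CA; set V := [set z | _].
(* The largest open set with trace on [A] inside [V]; it remains to find, around each point of [V]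
   in [A], one open set of this kind. *)
exists (\bigcup_(O in [set O | open O /\ O `&` A `<=` V]) O).
  by apply: bigcup_open => O [].
apply/seteqP; split=> [y [Vy Ay]|y []]; last first.
  by move=> [U [_ UV] Uy] Ay; split=> //; exact: UV.
split=> //.
(* Going from [l y] to [l z] through [f y] and [f z] costs at most [3 * d], less than the slack left
   at [y]. *)
pose d := (r - `|l x - l y|) / 4.
have d0 : 0 < d by rewrite divr_gt0// subr_gt0.
have [f cf fl] := lf A d CA d0.
have /(_ y)[|W [_ Wy Wf]] : localization_open C (f @^-1` ball (f y) d).
  apply: (@open_comp _ _ f) => [z _|]; [exact: cf|exact: ball_open].
  exact: ballxx.
(* On [A], the neighbourhood [W] for the localization is the trace of a set [U] open in the original
   topology. *)
move=> /(_ _ CA)[U oU WU].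
have : (U `&` A) y by rewrite -WU.
move=> [Uy _]; exists U => //; split => // z [Uz Az].
have : (W `&` A) z by rewrite WU.
move=> [/Wf + _]; rewrite /ball/= => yz.
have := fl _ Ay; have := fl _ Az; rewrite /V /=.
have := ler_distD (f z) (l y) (l z); have := ler_distD (f y) (l y) (f z).
have := ler_distD (l y) (l x) (l z); rewrite (distrC (l y) (f y)) /d in yz *.
move: Vy; rewrite /V/=; lra.
Qed.

Theorem theorem5p4 (R : realType) (X : tvsType R) (C : set_system X)
  (hX : hausdorff_space X)
  (hC : localizing_family C)
  (hCcount : nondecreasing_countable C)
  (hCclosed : forall A, C A -> closed A)
  (hCbounded : forall B : set X,
     @tvs_bounded R (localization C) B <-> exists2 A, C A & B `<=` A)
  (hC0 : exists2 C0, C C0 & forall A, C A ->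
     exists2 t : R, 0 < t & A `<=` [set t *: y | y in C0]) :
  banach_space (strong_dual (localization C)).
Proof.
have [_ Cconv Cabs] := hC.
have [C0 CC0 C0abs] := hC0.
have C0_neq0 : C0 !=set0 by exists 0; have [] := Cconv _ CC0.
have bounded A : C A -> @tvs_bounded R (localization C) A.
  by move=> CA; apply/hCbounded; exists A.
have absorbs B : @tvs_bounded R (localization C) B ->
    exists2 t : R, 0 < t & B `<=` [set t *: y | y in C0].
  move=> /hCbounded[A /C0abs[t t0 At] BA]; exists t => //.
  exact: subset_trans At.
have points x : @tvs_bounded R (localization C) [set x].
  (* With scalar [0] the translate [x + 0 *: C0] is just the point [x]. *)
  apply/hCbounded; have [D CD xD] := Cabs _ x 0 CC0.
  exists D => // _ ->; apply: xD; have [y C0y] := C0_neq0.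
  by exists y; rewrite // scale0r addr0.
exists (@dual_norm R (localization C) C0); split.
- exact: (@dual_norm_is_norm R (localization C) C0 C0_neq0 (bounded _ CC0)).
- apply: (@dual_norm_complete R (localization C) C0) => //.
    exact: bounded.
  move=> l ll lf; apply: localization_continuous => // A e CA e0.
  (* An [e / t] approximation on [C0] is, by homogeneity, an [e] approximation on [A]. *)
  have [t t0 At] := C0abs _ CA.
  have [f fl] := lf _ (divr_gt0 e0 t0).
  exists f; first exact: dual_continuous.
  move=> _ /At[y C0y <-].
  rewrite dual_funZ (linear_formZ _ _ _ ll) -mulrBr normrM gtr0_norm//.
  by rewrite mulrC -ler_pdivlMr//; exact: fl.
- exact: (@dual_norm_induces_topology R (localization C) C0 C0_neq0
    (bounded _ CC0)).
Qed.
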